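(* Let $D_{\infty}$ be the infinite dihedral group and $D_{2^{\infty}}$ the locally dihedral group. Then the power graph $\mathrm{Pow}(D_{2^{\infty}})$ is isomorphic (as a graph) to the commuting graph $\mathrm{Com}(D_{\infty})$. Furthermore, $\mathrm{Pow}(D_\infty)\neq \mathrm{Com}(D_\infty)$ and $\mathrm{Pow}(D_{2^\infty})\neq\mathrm{Com}(D_{2^\infty})$.
   Context: All graphs are undirected and simple. For a group $G$, $\mathrm{Pow}(G)$ is the graph with vertex set $G$ in which two distinct vertices are adjacent if one is an (integer) power of the other; $\mathrm{Com}(G)$ is the graph with vertex set $G$ in which two distinct vertices $x,y$ are adjacent if $xy=yx$. Equality of two graphs on the same vertex set $G$ means that they have the same edge set. The infinite dihedral group is $D_{\infty} = \langle r,t \mid t^2=1,\ trt=r^{-1}\rangle$. $C_{2^\infty}$ denotes the Prüfer 2-group, $C_{2^{\infty}} = \langle g_1,g_2,g_3,\ldots \mid g_1^2=1,\ g_2^2=g_1,\ g_3^2=g_2,\ldots\rangle$. The locally dihedral group (the union of the chain of dihedral groups of orders $8,16,32,\ldots$) has the presentation $$D_{2^{\infty}} = \langle C,s \mid C\cong C_{2^\infty},\ s^2=1,\ scs=c^{-1}\text{ for every } c\in C\rangle,$$ i.e. it is the semidirect product $C\rtimes\langle s\rangle$ with $s$ of order 2 acting by inversion. *)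

(* Defs.v *)
From HB Require Import structures.
From mathcomp Require Import all_boot all_order all_algebra.
From mathcomp Require Import boolp.

Set Implicit Arguments.
Unset Strict Implicit.
Unset Printing Implicit Defensive.

Local Open Scope quotient_scope.

(* A word over X is a list of signed generators: (x, true) stands for x and
   (x, false) for its formal inverse. *)
Definition word (X : Type) := seq (X * bool).

Definition gen (X : Type) (x : X) : word X := [:: (x, true)].

Definition word_inv (X : Type) (w : word X) : word X :=
  rev [seq (l.1, ~~ l.2) | l <- w].

(* R u v means that u = v is one of the defining relations; [pres_eq R] is the
   least congruence on words containing R and free cancellation, so its
   quotient is the free group on X modulo the normal closure of the
   relators. *)
Inductive pres_eq (X : Type) (R : word X -> word X -> Prop) :
    word X -> word X -> Prop :=
| pres_refl u : pres_eq R u u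
| pres_sym u v : pres_eq R u v -> pres_eq R v u
| pres_trans v u w : pres_eq R u v -> pres_eq R v w -> pres_eq R u w
| pres_cat u1 v1 u2 v2 :
    pres_eq R u1 v1 -> pres_eq R u2 v2 -> pres_eq R (u1 ++ u2) (v1 ++ v2)
| pres_cancel x b : pres_eq R [:: (x, b); (x, ~~ b)] [::]
| pres_rel u v : R u v -> pres_eq R u v.

Section PresentedGroup.
Variables (X : choiceType) (R : word X -> word X -> Prop).

Definition pres_eqb : rel (word X) := fun u v => `[< pres_eq R u v >].

Lemma pres_eqb_refl : reflexive pres_eqb.
Proof. by move=> u; apply/asboolP/pres_refl. Qed.

Lemma pres_eqb_sym : symmetric pres_eqb.
Proof. by move=> u v; apply/asboolP/asboolP => /pres_sym. Qed.

Lemma pres_eqb_trans : transitive pres_eqb.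
Proof. by move=> v u w /asboolP uv /asboolP vw; apply/asboolP/(pres_trans uv). Qed.

Canonical pres_equiv :=
  EquivRel pres_eqb pres_eqb_refl pres_eqb_sym pres_eqb_trans.

Definition presented_group := {eq_quot pres_equiv}.

HB.instance Definition _ := Choice.on presented_group.

Definition pres_class (w : word X) : presented_group := \pi w.

Definition pres_mul (a b : presented_group) : presented_group :=
  pres_class (repr a ++ repr b).
Definition pres_one : presented_group := pres_class [::].
Definition pres_inv (a : presented_group) : presented_group :=
  pres_class (word_inv (repr a)).

Lemma pres_classP u v : pres_class u = pres_class v <-> pres_eq R u v.
Proof.
split; first by move/eqmodP/asboolP.
by move=> uv; apply/eqmodP/asboolP.
Qed.

Lemma pres_repr u : pres_eq R (repr (pres_class u)) u.
Proof. by apply/pres_classP; rewrite /pres_class reprK. Qed.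

Lemma pres_class_ind (P : presented_group -> Prop) :
  (forall w, P (pres_class w)) -> forall a, P a.
Proof. by move=> Pw a; rewrite -[a]reprK; apply: Pw. Qed.

Lemma pres_mulE u v :
  pres_mul (pres_class u) (pres_class v) = pres_class (u ++ v).
Proof. by apply/pres_classP/pres_cat; apply: pres_repr. Qed.

Lemma pres_invr w : pres_eq R (w ++ word_inv w) [::].
Proof.
elim: w => [|[x b] w IHw]; first exact: pres_refl.
have -> : ((x, b) :: w) ++ word_inv ((x, b) :: w) =
    [:: (x, b)] ++ (w ++ word_inv w) ++ [:: (x, ~~ b)].
  by rewrite /word_inv /= rev_cons -cats1 catA.
apply: pres_trans (pres_cancel R x b).
apply: (pres_cat (pres_refl R [:: (x, b)])).
exact: (pres_cat IHw (pres_refl R [:: (x, ~~ b)])).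
Qed.

Lemma word_invK : involutive (@word_inv X).
Proof.
move=> w; rewrite /word_inv map_rev revK -map_comp -[RHS]map_id.
by apply: eq_map => -[x b] /=; rewrite negbK.
Qed.

Lemma pres_invl w : pres_eq R (word_inv w ++ w) [::].
Proof. by rewrite -{2}[w]word_invK; apply: pres_invr. Qed.

Lemma pres_mulA : associative pres_mul.
Proof.
elim/pres_class_ind=> u; elim/pres_class_ind=> v; elim/pres_class_ind=> w.
by rewrite !pres_mulE catA.
Qed.

Lemma pres_mul1 : left_id pres_one pres_mul.
Proof. by elim/pres_class_ind=> u; rewrite pres_mulE. Qed.

Lemma pres_mulr1 : right_id pres_one pres_mul.
Proof. by elim/pres_class_ind=> u; rewrite pres_mulE cats0. Qed.

Lemma pres_mulV : left_inverse pres_one pres_inv pres_mul.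
Proof.
by move=> a; rewrite -{2}[a]reprK pres_mulE; apply/pres_classP/pres_invl.
Qed.

Lemma pres_mulrV : right_inverse pres_one pres_inv pres_mul.
Proof.
by move=> a; rewrite -{1}[a]reprK pres_mulE; apply/pres_classP/pres_invr.
Qed.

HB.instance Definition _ := isGroup.Build presented_group
  pres_mulA pres_mul1 pres_mulr1 pres_mulV pres_mulrV.

End PresentedGroup.

Inductive dinf_gen := gen_r | gen_t.

HB.instance Definition _ := gen_eqMixin dinf_gen.
HB.instance Definition _ := gen_choiceMixin dinf_gen.

Inductive dinf_rel : word dinf_gen -> word dinf_gen -> Prop :=
| dinf_tt : dinf_rel (gen gen_t ++ gen gen_t) [::]
| dinf_trt :
    dinf_rel (gen gen_t ++ gen gen_r ++ gen gen_t) (word_inv (gen gen_r)).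

Definition Dinf : groupType := presented_group dinf_rel.

(* Generators are indexed from 0: index i stands for the generator g_{i+1}. *)
Inductive prufer2_rel : word nat -> word nat -> Prop :=
| prufer2_0 : prufer2_rel (gen 0 ++ gen 0) [::]
| prufer2_S i : prufer2_rel (gen i.+1 ++ gen i.+1) (gen i).

Definition Prufer2 : groupType := presented_group prufer2_rel.

(* Generators: Some c for c in the Pruefer group, and None for s.  The first
   family of relations is the multiplication table of the Pruefer group. *)
Inductive d2inf_rel : word (option Prufer2) -> word (option Prufer2) -> Prop :=
| d2inf_mul (c d : Prufer2) :
    d2inf_rel (gen (Some c) ++ gen (Some d)) (gen (Some (c * d)%g))
| d2inf_ss : d2inf_rel (gen None ++ gen None) [::]
| d2inf_scs (c : Prufer2) :
    d2inf_rel (gen None ++ gen (Some c) ++ gen None)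
              (word_inv (gen (Some c))).

Definition D2inf : groupType := presented_group d2inf_rel.

Record sgraph (V : Type) := SGraph {
  adj : V -> V -> Prop;
  adj_sym : forall x y, adj x y -> adj y x;
  adj_irr : forall x, ~ adj x x
}.

Definition same_edges (V : Type) (A B : sgraph V) : Prop :=
  forall x y, adj A x y <-> adj B x y.

Definition graph_iso (V W : Type) (A : sgraph V) (B : sgraph W) : Prop :=
  exists2 f : V -> W, bijective f
    & forall x y, adj A x y <-> adj B (f x) (f y).

Definition int_power (G : groupType) (x : G) (k : int) : G :=
  match k with
  | Posz n => (x ^+ n)%g
  | Negz n => (x ^- n.+1)%g
  end.

Definition is_power (G : groupType) (y x : G) : Prop :=
  exists k : int, y = int_power x k.

Definition pow_adj (G : groupType) (x y : G) : Prop :=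
  x <> y /\ (is_power y x \/ is_power x y).

Lemma pow_adj_sym (G : groupType) (x y : G) : pow_adj x y -> pow_adj y x.
Proof. by case=> xy [?|?]; split; [exact/nesym | right | exact/nesym | left]. Qed.

Lemma pow_adj_irr (G : groupType) (x : G) : ~ pow_adj x x.
Proof. by case. Qed.

Definition Pow (G : groupType) : sgraph G :=
  SGraph (@pow_adj_sym G) (@pow_adj_irr G).

Definition com_adj (G : groupType) (x y : G) : Prop :=
  x <> y /\ commute x y.

Lemma com_adj_sym (G : groupType) (x y : G) : com_adj x y -> com_adj y x.
Proof. by case=> xy cxy; split; [exact/nesym | rewrite /commute cxy]. Qed.

Lemma com_adj_irr (G : groupType) (x : G) : ~ com_adj x x.
Proof. by case. Qed.

Definition Com (G : groupType) : sgraph G :=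
  SGraph (@com_adj_sym G) (@com_adj_irr G).

(* Main.v *)
Require Import Defs.
From mathcomp Require Import all_boot all_order all_algebra algC.
From mathcomp Require Import boolp classical_sets functions cardinality.
From mathcomp Require Import zify.

Set Implicit Arguments.
Unset Strict Implicit.
Unset Printing Implicit Defensive.

(* Every element of D_{2^infty} is uniquely c s^b with c in the Pruefer group P,
   and every element of D_infty is uniquely r^n t^b.  In P, of any two elements
   one is a power of the other, while each c s is an involution; in D_infty the
   rotations commute with each other, while a reflection commutes only with 1
   and itself.  Hence both graphs are a countably infinite clique together with
   countably many pendant vertices, all attached to the identity.  The normal
   forms are read off from words through actions of the presented groups; that
   P is nontrivial (hence infinite) is seen by letting g_i multiply by a
   2^i-th root of -1. *)

Import GRing.Theory Num.Theory.

Local Open Scope group_scope.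

(** * Presented groups: words, actions and induction on generators *)

Lemma pres_class_genV (X : choiceType) (R : word X -> word X -> Prop) (x : X) :
  (pres_class R (gen x) : presented_group R)^-1 = pres_class R [:: (x, false)].
Proof.
by apply: mulg1_eq; rewrite [LHS](@pres_mulE _ R); apply/pres_classP/pres_cancel.
Qed.

Lemma pres_class_cons (X : choiceType) (R : word X -> word X -> Prop) l w :
  pres_class R (l :: w) = pres_class R [:: l] * pres_class R w.
Proof. by rewrite [RHS](@pres_mulE _ R). Qed.

Section PresentedAction.
Variables (X : choiceType) (R : word X -> word X -> Prop).
Variables (T : Type) (act : X * bool -> T -> T).
Hypothesis actK : forall x b p, act (x, b) (act (x, ~~ b) p) = p.
Hypothesis act_rel : forall u v, R u v -> forall p, foldr act p u = foldr act p v.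

Local Notation G := (presented_group R : groupType).
Local Notation "[ 'gen' x ]" := (pres_class R (gen x) : G).

(** This makes [pact] independent of the word chosen by [repr]. Since [foldr] applies the last
    letter first, concatenation of words becomes composition of a left action. *)
Lemma act_pres_eq u v p : pres_eq R u v -> foldr act p u = foldr act p v.
Proof.
move=> uv.
elim: uv p => {u v} [//|u v _ IH|u v w _ IH1 _ IH2
  |u1 v1 u2 v2 _ IH1 _ IH2|x b|u v Ruv] p.
- by rewrite IH.
- by rewrite IH1 IH2.
- by rewrite !foldr_cat IH2 IH1.
- exact: actK.
- exact: act_rel.
Qed.

Definition pact (g : G) (p : T) : T := foldr act p (repr g).

Lemma pact_class w p : pact (pres_class R w) p = foldr act p w.
Proof. exact/act_pres_eq/pres_repr. Qed.

Lemma pactM (g h : G) p : pact (g * h) p = pact g (pact h p).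
Proof. by rewrite [g * h]/(pres_mul g h) pact_class foldr_cat. Qed.

Lemma pact1 p : pact 1 p = p.
Proof. exact: (pact_class [::]). Qed.

Lemma pact_gen x p : pact [gen x] p = act (x, true) p.
Proof. exact: pact_class. Qed.

Lemma pactK (g : G) p : pact g^-1 (pact g p) = p.
Proof. by rewrite -pactM mulVg pact1. Qed.

(** If moreover [e p0 = 1], this gives [e (pact g p0) = g], so every element has a normal form.
    Positive generators suffice in the hypothesis: [actK] and cancellation by the generator handle
    the inverse letters. *)
Lemma equivariant_orbit (e : T -> G) :
    (forall x p, e (act (x, true) p) = [gen x] * e p) ->
  forall (g : G) p, e (pact g p) = g * e p.
Proof.
move=> eM; elim/pres_class_ind => w p; rewrite pact_class.
elim: w => [|[x b] w IHw]; first by rewrite [pres_class _ _]/(1 : G) mul1g.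
rewrite pres_class_cons /= -mulgA -IHw; case: b => //.
by apply: (mulgI [gen x]); rewrite -eM actK -pres_class_genV mulVKg.
Qed.

End PresentedAction.

Lemma pres_gen_ind (X : choiceType) (R : word X -> word X -> Prop)
    (P : presented_group R -> Prop) :
    P 1 ->
    (forall x g, P g -> P (pres_class R (gen x) * g)) ->
    (forall x g, P g -> P ((pres_class R (gen x) : presented_group R)^-1 * g)) ->
  forall g, P g.
Proof.
move=> P1 PM PV; elim/pres_class_ind; elim=> [//|[x [|]] w IHw].
  by rewrite pres_class_cons; apply: PM.
by rewrite pres_class_cons -pres_class_genV; apply: PV.
Qed.

(** * Countable sets and integer powers *)

Lemma countably_infinite_bij_nat (T : Type) (f : nat -> T) (h : T -> nat) :
  injective f -> injective h -> exists g : T -> nat, bijective g.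
Proof.
move=> f_inj h_inj.
suff /card_set_bijP[g] : ([set: T] #= [set: nat])%card by rewrite setTT_bijective; exists g.
apply: eq_card_nat.
  by apply/countable_injP; exists h => x y _ _; apply: h_inj.
apply/infiniteP; have /card_le_eql <- : (f @` [set: nat] #= [set: nat])%card.
  by apply: inj_card_eq => x y _ _; apply: f_inj.
exact: subset_card_le.
Qed.

Lemma commute_int_power (G : groupType) (x : G) k l :
  commute (int_power x k) (int_power x l).
Proof.
have cV y z : commute y z -> commute y z^-1 := @commuteV G y z.
have cX m n : commute (x ^+ m) (x ^+ n) := commuteX2 m n (commute_refl x).
case: k l => m [n|n] //=.
- exact: cV.
- exact/commute_sym/cV.
- exact/cV/commute_sym/cV.
Qed.

Lemma int_powerS (G : groupType) (x : G) k : int_power x (k + 1)%R = x * int_power x k.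
Proof.
case: k => [n|[|n]].
- by rewrite -[(Posz n + 1)%R]/(Posz (n + 1)) addn1 /= expgS.
- by rewrite /= expg1 mulgV.
have -> : (Negz n.+1 + 1 = Negz n)%R by lia.
by rewrite /= [in RHS]expgSr invgM mulVKg.
Qed.

(** * The Prüfer 2-group *)

Section Prufer.

Let g (i : nat) : Prufer2 := pres_class prufer2_rel (gen i).

Lemma prufer2_gen0 : g 0 ^+ 2 = 1.
Proof. by rewrite expg2 [LHS](@pres_mulE _ _); apply/pres_classP/pres_rel/prufer2_0. Qed.

Lemma prufer2_genS i : g i.+1 ^+ 2 = g i.
Proof. by rewrite expg2 [LHS](@pres_mulE _ _); apply/pres_classP/pres_rel/prufer2_S. Qed.

Lemma prufer2_genD i k : g (i + k) ^+ (2 ^ k) = g i.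
Proof.
elim: k => [|k IHk]; first by rewrite addn0 expg1.
by rewrite expnS expgnA addnS prufer2_genS.
Qed.

Lemma prufer2_gen_order i : g i ^+ (2 ^ i.+1) = 1.
Proof. by rewrite expnSr expgnA -{1}[i]add0n prufer2_genD prufer2_gen0. Qed.

(** A model of the generators in the multiplicative group of [algC]: [root 0] is -1 and the square
    of [root i.+1] is [root i]. *)
Let root (i : nat) : algC := iter i sqrtC (-1)%R.
Let act (l : nat * bool) (z : algC) : algC :=
  if l.2 then (root l.1 * z)%R else (z / root l.1)%R.

Lemma prufer2_gen0_neq1 : g 0 <> 1.
Proof.
have root_neq0 i : root i != 0%R.
  by elim: i => [|i IHi]; rewrite /root ?iterS ?sqrtC_eq0 // oppr_eq0 oner_eq0.
have actK x b z : act (x, b) (act (x, ~~ b) z) = z.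
  by case: b; rewrite /act /= mulrC ?divfK ?mulKf.
have act_rel u v : prufer2_rel u v -> forall z, foldr act z u = foldr act z v.
  case=> [|i] z; rewrite /act /= mulrA; first by rewrite /root /= mulrNN mulr1 mul1r.
  by rewrite -expr2 sqrtCK.
move=> /(congr1 (fun x => pact act x 1%R)).
rewrite (pact_gen actK act_rel) (pact1 actK act_rel) /act /root /= mulr1.
move/eqP; rewrite eq_sym -addr_eq0 -(natrD _ 1 1) pnatr_eq0 //.
Qed.

Lemma prufer2_gen_inj : injective g.
Proof.
move=> m n; wlog lt_mn : m n / (m < n)%N => [hw|].
  by case: (ltngtP m n) => // [/hw|/hw /[swap] ->] // /(_ erefl) ->.
(* The exponent [2 ^ n] turns [g n] into [g 0], but kills [g m] because [2 ^ m.+1] divides it. *)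
move/(congr1 (fun x => x ^+ (2 ^ n))); rewrite -{2}[n]add0n prufer2_genD.
rewrite -(subnKC lt_mn) expnD expgnA prufer2_gen_order expg1n.
by move/esym/prufer2_gen0_neq1.
Qed.

Lemma prufer2_gen_power (c : Prufer2) : exists n k, c = g n ^+ k.
Proof.
have genM i n k : exists n' k', g i * g n ^+ k = g n' ^+ k'.
  (* Both factors are powers of [g (i + n)], with exponents [2 ^ n] and [2 ^ i * k]. *)
  exists (i + n)%N, (2 ^ n + 2 ^ i * k)%N.
  by rewrite expgnDr prufer2_genD expgnA [in RHS]addnC prufer2_genD.
(* Finite order makes the inverse a nonnegative power, so iterating [genM] covers it. *)
have genV i : (g i)^-1 = g i ^+ (2 ^ i.+1).-1.
  by apply: mulg1_eq; rewrite -expgS prednK ?expn_gt0 // prufer2_gen_order.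
elim/pres_gen_ind: c => [|i _ [n [k ->]]|i _ [n [k ->]]].
- by exists 0, 0; rewrite expg0.
- exact: genM.
rewrite -/(g i) genV; elim: _.-1 => [|m [n' [k' IHm]]].
  by exists n, k; rewrite expg0 mul1g.
by rewrite expgS -mulgA IHm; apply: genM.
Qed.

(** The subgroup generated by [x ^+ a] depends only on gcd(a, 2^M), which is a power of 2, and
    powers of 2 are totally ordered by divisibility. *)
Lemma cyclic2_power_chain (G : groupType) (x : G) M a b : x ^+ (2 ^ M) = 1 ->
  is_power (x ^+ a) (x ^+ b) \/ is_power (x ^+ b) (x ^+ a).
Proof.
move=> xM.
have /(dvdn_pfactor _ _ (isT : prime 2))[i _ ai] := dvdn_gcdr a (2 ^ M).
have /(dvdn_pfactor _ _ (isT : prime 2))[j _ bj] := dvdn_gcdr b (2 ^ M).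
wlog le_ij : a b i j ai bj / (i <= j)%N => [hw|].
  have [/hw|/ltnW/hw] := leqP i j; first exact.
  by move=> /(_ b a) H; apply/or_comm/H.
case: (posnP a) => [->|a_gt0]; first by left; exists 0%R.
(* Bézout gives [u * a = v * 2 ^ M + 2 ^ i], so [x ^+ (2 ^ i)] is a power of [x ^+ a]; positivity of
   [a] is required here. *)
right; have [u v uv _] := egcdnP (2 ^ M) a_gt0.
have xi : x ^+ (2 ^ i) = (x ^+ a) ^+ u.
  by rewrite -expgnA mulnC uv expgnDr mulnC expgnA xM expg1n mul1g ai.
have /dvdnP[q ->] : (2 ^ i %| b)%N.
  by apply: dvdn_trans (dvdn_gcdl b (2 ^ M)); rewrite bj dvdn_exp2l.
by exists (Posz (u * q)); rewrite /= mulnC expgnA xi -expgnA.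
Qed.

Lemma prufer2_power_chain (c d : Prufer2) : is_power c d \/ is_power d c.
Proof.
have [m [a ->]] := prufer2_gen_power c; have [n [b ->]] := prufer2_gen_power d.
(* Both elements become powers of the common generator [g (m + n)]. *)
rewrite -(prufer2_genD m n) -(prufer2_genD n m) (addnC n) -!expgnA.
exact: cyclic2_power_chain (prufer2_gen_order _).
Qed.

Lemma prufer2_mulC (c d : Prufer2) : c * d = d * c.
Proof.
have int_power1 (x : Prufer2) : x = int_power x 1 by rewrite /= expg1.
have [[k ->]|[k ->]] := prufer2_power_chain c d.
  by rewrite {2 3}[d]int_power1; apply: commute_int_power.
by rewrite {1 4}[c]int_power1; apply: commute_int_power.
Qed.

(** Both sets are countably infinite. The condition at 1 will make the graph isomorphism send
    identity to identity; a translation of the integers achieves it. *)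
Lemma prufer2_bij_int : exists2 h : Prufer2 -> int, bijective h & h 1 = 0%R.
Proof.
have [u u_bij] : exists u : Prufer2 -> nat, bijective u.
  apply: (countably_infinite_bij_nat (h := pickle \o repr) prufer2_gen_inj).
  exact: inj_comp (pcan_inj pickleK) (can_inj reprK).
have [v [v' vK v'K]] : exists v : int -> nat, bijective v.
  apply: (countably_infinite_bij_nat (f := Posz) (h := pickle));
    last exact: pcan_inj pickleK.
  by move=> m n [].
exists (fun c => v' (u c) - v' (u 1%g))%R; last by rewrite subrr.
case: u_bij => u' uK u'K; exists (fun k => u' (v (k + v' (u 1%g))%R)) => k.
  by rewrite subrK v'K uK.
by rewrite u'K vK addrK.
Qed.

End Prufer.

(** * The locally dihedral group and its power graph *)

Section LocallyDihedral.

Local Notation iota c := (pres_class d2inf_rel (gen (Some c)) : D2inf).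
Local Notation s := (pres_class d2inf_rel (gen None) : D2inf).

Lemma d2inf_iotaM c d : iota (c * d) = iota c * iota d.
Proof. by rewrite [RHS](@pres_mulE _ _); apply/pres_classP/pres_sym/pres_rel/d2inf_mul. Qed.

Lemma d2inf_iota1 : iota 1 = 1.
Proof. by apply: (mulgI (iota 1)); rewrite -d2inf_iotaM !mulg1. Qed.

Lemma d2inf_iotaV c : iota c^-1 = (iota c)^-1.
Proof. by apply/esym/mulg1_eq; rewrite -d2inf_iotaM mulgV d2inf_iota1. Qed.

Lemma d2inf_iota_power c k : int_power (iota c) k = iota (int_power c k).
Proof.
have iX n : iota (c ^+ n) = iota c ^+ n.
  elim: n => [|n IHn]; first exact: d2inf_iota1.
  by rewrite !expgS d2inf_iotaM IHn.
by case: k => n /=; rewrite ?d2inf_iotaV iX.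
Qed.

Lemma d2inf_s2 : s * s = 1.
Proof. by rewrite [LHS](@pres_mulE _ _); apply/pres_classP/pres_rel/d2inf_ss. Qed.

Lemma d2inf_s_iota c : s * iota c = iota c^-1 * s.
Proof.
have scs : s * (iota c * s) = (iota c)^-1.
  rewrite [iota c * s](@pres_mulE _ d2inf_rel) [LHS](@pres_mulE _ _).
  by rewrite pres_class_genV; apply/pres_classP/pres_rel/d2inf_scs.
by rewrite d2inf_iotaV -scs mulgA -!mulgA d2inf_s2 mulg1.
Qed.

Definition d2inf_elt (p : Prufer2 * bool) : D2inf :=
  iota p.1 * (if p.2 then s else 1).

Lemma d2inf_elt_bij : bijective d2inf_elt.
Proof.
(* Left multiplication on normal forms, where s moves past c by inverting it; the orbit map of
   [(1, false)] is the inverse of [d2inf_elt]. *)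
pose act (l : option Prufer2 * bool) (p : Prufer2 * bool) :=
  if l.1 is Some c then (if l.2 then c * p.1 else c^-1 * p.1, p.2)
  else (p.1^-1, ~~ p.2).
have actK x b p : act (x, b) (act (x, ~~ b) p) = p.
  case: x p => [c|] [d e]; rewrite /act /= ?invgK ?negbK //.
  by case: b; rewrite /= ?mulKg ?mulVKg.
have act_rel u v : d2inf_rel u v -> forall p, foldr act p u = foldr act p v.
  case=> [c d|  |c] [x e]; rewrite /act /= ?mulgA ?invgK ?negbK //.
  (* The relation scs = c^-1 holds for the action because inversion is an automorphism of an abelian
     group. *)
  by rewrite invgM invgK prufer2_mulC.
exists (fun g => pact act g (1, false)) => [[c b]|g].
  rewrite /d2inf_elt /= (pactM actK act_rel) (pact_gen actK act_rel).
  case: b; rewrite ?(pact_gen actK act_rel) ?(pact1 actK act_rel) /act /=.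
    by rewrite invg1 mulg1.
  by rewrite mulg1.
rewrite (equivariant_orbit actK act_rel).
  by rewrite /d2inf_elt /= d2inf_iota1 !mulg1.
case=> [c|] [d e]; rewrite /d2inf_elt /act /=.
  by rewrite d2inf_iotaM mulgA.
rewrite mulgA d2inf_s_iota -mulgA; congr (_ * _).
by case: e; rewrite ?d2inf_s2 ?mulg1.
Qed.

Lemma d2inf_elt_inj : injective d2inf_elt.
Proof. exact: bij_inj d2inf_elt_bij. Qed.

Lemma d2inf_elt1 : d2inf_elt (1, false) = 1.
Proof. by rewrite /d2inf_elt /= d2inf_iota1 mulg1. Qed.

Lemma d2inf_power_rotation (c : Prufer2) (q : Prufer2 * bool) :
  is_power (d2inf_elt q) (d2inf_elt (c, false)) <-> q.2 = false /\ is_power q.1 c.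
Proof.
case: q => d b; rewrite /is_power {2}/d2inf_elt /= mulg1; split.
  move=> [k]; rewrite d2inf_iota_power -[iota _]mulg1.
  by move/(@d2inf_elt_inj _ (_, false)) => [-> ->]; split=> //; exists k.
by move=> [-> [k ->]]; exists k; rewrite d2inf_iota_power /d2inf_elt mulg1.
Qed.

Lemma d2inf_power_reflection (c : Prufer2) (q : Prufer2 * bool) :
  is_power (d2inf_elt q) (d2inf_elt (c, true)) -> q = (1, false) \/ q = (c, true).
Proof.
set x := d2inf_elt (c, true).
have xV : x^-1 = x.
  apply: mulg1_eq; rewrite /x /d2inf_elt /= mulgA -(mulgA (iota c)) d2inf_s_iota.
  by rewrite mulgA -d2inf_iotaM mulgV d2inf_iota1 mul1g d2inf_s2.
have xX n : x ^+ n = 1 \/ x ^+ n = x.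
  elim: n => [|n [IHn|IHn]]; first by left.
    by right; rewrite expgS IHn mulg1.
  by left; rewrite expgS IHn -{2}xV mulgV.
move=> [k qk]; suff : d2inf_elt q = 1 \/ d2inf_elt q = x.
  by rewrite -d2inf_elt1 => -[/d2inf_elt_inj|/d2inf_elt_inj] ->; [left|right].
by rewrite qk; case: k {qk} => n /=; rewrite -?expVgn ?xV; apply: xX.
Qed.

(** Stated in coordinates so that it matches [dinf_com_adj] up to the name of the identity
    vertex. *)
Lemma d2inf_pow_adj (p q : Prufer2 * bool) :
  adj (Pow D2inf) (d2inf_elt p) (d2inf_elt q) <->
  p <> q /\ [\/ p.2 = false /\ q.2 = false, p = (1, false) | q = (1, false)].
Proof.
have -> : adj (Pow D2inf) (d2inf_elt p) (d2inf_elt q) <->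
    p <> q /\ (is_power (d2inf_elt q) (d2inf_elt p) \/
               is_power (d2inf_elt p) (d2inf_elt q)).
  by split=> -[pq pw]; split=> //; [move/(congr1 d2inf_elt) | move/d2inf_elt_inj].
have pow1 x : is_power (d2inf_elt (1, false)) x.
  by rewrite d2inf_elt1; exists (Posz 0); rewrite /= expg0.
split=> -[pq pw]; split=> //.
  case: p q pq pw => [c [|]] [d [|]] pq [pw|pw].
  - by case: (d2inf_power_reflection pw) => // /esym.
  - by case: (d2inf_power_reflection pw).
  - case: (d2inf_power_reflection pw) => // ->; exact: Or33.
  - by case/d2inf_power_rotation: pw.
  - by case/d2inf_power_rotation: pw.
  - case: (d2inf_power_reflection pw) => // ->; exact: Or32.
  - exact: Or31.
  - exact: Or31.
case: pw => [[p2 q2]|->|->]; [|by right|by left].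
case: p q p2 q2 {pq} => [c _] [d _] /= -> ->.
by case: (prufer2_power_chain c d) => cd; [right|left]; apply/d2inf_power_rotation.
Qed.

Lemma d2inf_Pow_neq_Com : ~ same_edges (Pow D2inf) (Com D2inf).
Proof.
pose g0 : Prufer2 := pres_class prufer2_rel (gen 0).
have g0V : g0^-1 = g0 by apply: mulg1_eq; rewrite -expg2 prufer2_gen0.
(* The involution [g0] equals its inverse, hence commutes with s; yet neither is the identity and s
   is a reflection, so they are not adjacent in the power graph. *)
move=> /(_ (d2inf_elt (g0, false)) (d2inf_elt (1, true))) [_].
case/(_ _)/d2inf_pow_adj => [|_ [[]|[]|]] //; last exact: prufer2_gen0_neq1.
split; first by move/d2inf_elt_inj.
by rewrite /commute /d2inf_elt /= d2inf_iota1 mulg1 mul1g d2inf_s_iota g0V.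
Qed.

End LocallyDihedral.

(** * The infinite dihedral group and its commuting graph *)

Section InfiniteDihedral.

Local Notation r := (pres_class dinf_rel (gen gen_r) : Dinf).
Local Notation t := (pres_class dinf_rel (gen gen_t) : Dinf).

Let act (l : dinf_gen * bool) (p : int * bool) : int * bool :=
  match l with
  | (gen_r, b) => ((if b then p.1 + 1 else p.1 - 1)%R, p.2)
  | (gen_t, _) => ((- p.1)%R, ~~ p.2)
  end.

Let actK x b p : act (x, b) (act (x, ~~ b) p) = p.
Proof. by case: x b p => [] [] [n e] /=; rewrite ?subrK ?addrK ?opprK ?negbK. Qed.

Let act_rel u v : dinf_rel u v -> forall p, foldr act p u = foldr act p v.
Proof. by case=> -[n b] /=; rewrite ?opprK ?negbK // opprD opprK. Qed.

Local Notation dact := (pact act).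

Lemma dinf_t2 : t * t = 1.
Proof. by rewrite [LHS](@pres_mulE _ _); apply/pres_classP/pres_rel/dinf_tt. Qed.

Lemma dinf_tr : t * r = r^-1 * t.
Proof.
have trt : t * (r * t) = r^-1.
  rewrite [r * t](@pres_mulE _ dinf_rel) [LHS](@pres_mulE _ _).
  by rewrite pres_class_genV; apply/pres_classP/pres_rel/dinf_trt.
by rewrite -trt -!mulgA dinf_t2 mulg1.
Qed.

Lemma dinf_t_rotation n : t * int_power r n = int_power r (- n)%R * t.
Proof.
have tX k : t * r ^+ k = r ^- k * t.
  elim: k => [|k IHk]; first by rewrite expg0 invg1 mul1g mulg1.
  by rewrite expgSr mulgA IHk -mulgA dinf_tr mulgA -invgM -expgS expgSr.
case: n => [[|n]|n].
- by rewrite oppr0 /= mulg1 mul1g.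
- exact: (tX n.+1).
rewrite (_ : - Negz n = Posz n.+1)%R //.
apply: (mulgI (r ^- n.+1)); rewrite /= mulKg mulgA -tX -mulgA mulgV mulg1 //.
Qed.

Lemma dact_int_power (g : Dinf) (d : int) :
    (forall m b, dact g (m, b) = (m + d, b)%R) ->
  forall k m b, dact (int_power g k) (m, b) = (m + d * k, b)%R.
Proof.
move=> gd.
have gX n m b : dact (g ^+ n) (m, b) = (m + d * n%:Z, b)%R.
  elim: n m => [|n IHn] m; first by rewrite expg0 (pact1 actK act_rel) mulr0 addr0.
  by rewrite expgSr (pactM actK act_rel) gd IHn -addrA intS mulrDr mulr1.
case=> n m b; first exact: gX.
(* For negative exponents, undo the translation by the corresponding positive power. *)
rewrite /= -[RHS](pactK actK act_rel (g ^+ n.+1)) gX.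
by congr (dact _ (_, _)); rewrite NegzE mulrN subrK.
Qed.

Lemma dact_rotation n m b : dact (int_power r n) (m, b) = (m + n, b)%R.
Proof.
rewrite (@dact_int_power _ 1) ?mul1r // => {}m {}b.
by rewrite (pact_gen actK act_rel).
Qed.

Definition dinf_elt (p : int * bool) : Dinf :=
  int_power r p.1 * (if p.2 then t else 1).

(** This is the multiplication law of the semidirect product of the integers by a group of order 2
    acting by sign. *)
Lemma dact_elt p q :
  dact (dinf_elt p) q = (p.1 + (if p.2 then - q.1 else q.1), p.2 (+) q.2)%R.
Proof.
case: p q => [m b] [n c]; rewrite /dinf_elt (pactM actK act_rel) /= addrC.
case: b; rewrite /= ?(pact1 actK act_rel) ?(pact_gen actK act_rel) /=;
  exact: dact_rotation.
Qed.

Lemma dinf_eltK : cancel dinf_elt (fun g => dact g (0%R, false)).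
Proof. by case=> m b; rewrite dact_elt /= oppr0 if_same addr0 addbF. Qed.

Lemma dinf_elt_inj : injective dinf_elt.
Proof. exact: can_inj dinf_eltK. Qed.

Lemma dact_orbitK : cancel (fun g => dact g (0%R, false)) dinf_elt.
Proof.
move=> g; rewrite (equivariant_orbit actK act_rel).
  by rewrite /dinf_elt /= expg0 !mulg1.
case=> -[n b]; rewrite /dinf_elt /=.
  by rewrite int_powerS mulgA.
rewrite mulgA dinf_t_rotation -mulgA; congr (_ * _).
by case: b; rewrite ?dinf_t2 ?mulg1.
Qed.

Lemma dinf_elt_bij : bijective dinf_elt.
Proof. by exists (fun g => dact g (0%R, false)); [exact: dinf_eltK | exact: dact_orbitK]. Qed.

Lemma dinf_com_adj (p q : int * bool) :
  adj (Com Dinf) (dinf_elt p) (dinf_elt q) <->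
  p <> q /\ [\/ p.2 = false /\ q.2 = false, p = (0%R, false) | q = (0%R, false)].
Proof.
(* Acting on the coordinates of q gives the coordinates of the product, so commuting becomes an
   equation between pairs. *)
have -> : adj (Com Dinf) (dinf_elt p) (dinf_elt q) <->
    p <> q /\ dact (dinf_elt p) q = dact (dinf_elt q) p.
  have dactE p' q' :
      dact (dinf_elt p') q' = dact (dinf_elt p' * dinf_elt q') (0%R, false).
    by rewrite [RHS](pactM actK act_rel) (dinf_eltK q').
  rewrite !dactE.
  split=> -[pq c]; split; first by move/(congr1 dinf_elt).
  - by rewrite c.
  - by move/dinf_elt_inj.
  - exact: (can_inj dact_orbitK).
rewrite !dact_elt; case: p q => [m b] [n c] /=.
split=> -[]; case: b; case: c => /= mn H; split=> //.
(* Two reflections give m - n = n - m, hence m = n, against distinctness; in the two mixed cases the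
   equation forces the rotation to have exponent 0. *)
- by case: H => H; exfalso; apply: mn; congr (_, _); lia.
- by case: H => H; apply: Or33; congr (_, _); lia.
- by case: H => H; apply: Or32; congr (_, _); lia.
- exact: Or31.
- by case: H => [[]|[]|[]].
- by case: H => [[]|[]|[->]]; rewrite ?oppr0 ?addr0 ?add0r.
- by case: H => [[]|[->]|[]]; rewrite ?oppr0 ?addr0 ?add0r.
- by rewrite addrC.
Qed.

Lemma dinf_Pow_neq_Com : ~ same_edges (Pow Dinf) (Com Dinf).
Proof.
have powE d k : dact (int_power (dinf_elt (d, false)) k) (0%R, false) = (d * k, false)%R.
  rewrite (@dact_int_power _ d) ?add0r // => m b.
  by rewrite dact_elt /= addrC.
(* The rotations r^2 and r^3 commute, but neither 2k = 3 nor 3k = 2 has an integer solution. *)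
move=> /(_ (dinf_elt (2%R, false)) (dinf_elt (3%R, false))) [_].
case/(_ _) => [|_]; first by apply/dinf_com_adj; split=> //; apply: Or31.
case=> -[k /(congr1 (fun g => dact g (0%R, false)))]; rewrite dinf_eltK powE => -[];
  lia.
Qed.

End InfiniteDihedral.

(** * Matching the two graphs through normal forms *)

Theorem theorem5 :
  graph_iso (Pow D2inf) (Com Dinf)
  /\ ~ same_edges (Pow Dinf) (Com Dinf)
  /\ ~ same_edges (Pow D2inf) (Com D2inf).
Proof.
split; last by split; [exact: dinf_Pow_neq_Com | exact: d2inf_Pow_neq_Com].
have [h h_bij h1] := prufer2_bij_int; have h_inj := bij_inj h_bij.
have [nf eltK nfK] := d2inf_elt_bij.
pose f (p : Prufer2 * bool) := (h p.1, p.2).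
have f_inj : injective f by move=> [c b] [d e] [/h_inj -> ->].
(* As [f] keeps the reflection bit, only the identity vertex has to be matched; an equality of
   propositions allows rewriting inside the disjunction. *)
have f1 p : (f p = (0%R, false)) = (p = (1, false)).
  by apply/propext; rewrite -h1 -[(h 1, false)]/(f (1, false)); split=> [/f_inj|->].
exists (dinf_elt \o f \o nf) => [|x y].
  apply: bij_comp (bij_comp dinf_elt_bij _) _; last by exists d2inf_elt.
  case: h_bij => h' hK h'K; exists (fun p => (h' p.1, p.2)) => -[c b] /=.
    by rewrite /f /= hK.
  by rewrite /f /= h'K.
rewrite -{1}[x]nfK -{1}[y]nfK d2inf_pow_adj dinf_com_adj !f1 /=.
by split=> -[xy pq]; split=> //; [move/f_inj | move/(congr1 f)].
Qed.
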